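(* Let $N_x,N_y\geq 1$, $a_1=X_0<X_1<\dots<X_{N_x}=b_1$, $a_2=Y_0<Y_1<\dots<Y_{N_y}=b_2$, and $\Omega_{ij}=[X_i,X_{i+1}]\times[Y_j,Y_{j+1}]$ for $0\leq i\leq N_x-1$, $0\leq j\leq N_y-1$. For functions $u_{e_{ij}}:\Omega_{ij}\to\mathbb{R}$ consider the $C^0$ continuity conditions $$(\ast)\quad\begin{aligned}&u_{e_{ij}}(X_{i+1},y)=u_{e_{i+1,j}}(X_{i+1},y),\quad y\in[Y_j,Y_{j+1}],\ 0\leq i\leq N_x-2,\ 0\leq j\leq N_y-1,\\&u_{e_{ij}}(x,Y_{j+1})=u_{e_{i,j+1}}(x,Y_{j+1}),\quad x\in[X_i,X_{i+1}],\ 0\leq i\leq N_x-1,\ 0\leq j\leq N_y-2.\end{aligned}$$ Given functions $g_{e_{ij}}$ on $\Omega_{ij}$ ($0\leq i\leq N_x-1$, $0\leq j\leq N_y-1$), $\hat G_{ij}$ on $[Y_j,Y_{j+1}]$ ($0\leq i\leq N_x$, $0\leq j\leq N_y-1$), $\hat H_{ij}$ on $[X_i,X_{i+1}]$ ($0\leq i\leq N_x-1$, $0\leq j\leq N_y$), and parameters $\hat\alpha_{ij}\in\mathbb{R}$ ($0\leq i\leq N_x$, $0\leq j\leq N_y$), put $$G_{ij}(y)=\hat G_{ij}(y)+[\hat\alpha_{ij}-\hat G_{ij}(Y_j)]\phi_0(Y_j,Y_{j+1},y)+[\hat\alpha_{i,j+1}-\hat G_{ij}(Y_{j+1})]\phi_1(Y_j,Y_{j+1},y),$$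 $$H_{ij}(x)=\hat H_{ij}(x)+[\hat\alpha_{ij}-\hat H_{ij}(X_i)]\phi_0(X_i,X_{i+1},x)+[\hat\alpha_{i+1,j}-\hat H_{ij}(X_{i+1})]\phi_1(X_i,X_{i+1},x),$$ and consider, for $0\leq i\leq N_x-1$, $0\leq j\leq N_y-1$ and $(x,y)\in\Omega_{ij}$, $$(\ast\ast)\qquad u_{e_{ij}}(x,y)=g_{e_{ij}}(x,y)-\mathbf{v}_1^T(x)\mathbf{M}_g\mathbf{v}_2(y)+\mathbf{v}_1^T(x)\mathbf{M}_b\mathbf{v}_2(y),$$ where $\mathbf{v}_1(x)=[1,\ \phi_0(X_i,X_{i+1},x),\ \phi_1(X_i,X_{i+1},x)]^T$, $\mathbf{v}_2(y)=[1,\ \phi_0(Y_j,Y_{j+1},y),\ \phi_1(Y_j,Y_{j+1},y)]^T$, $$\mathbf{M}_g=\begin{bmatrix}0&g_{e_{ij}}(x,Y_j)&g_{e_{ij}}(x,Y_{j+1})\\ g_{e_{ij}}(X_i,y)&-g_{e_{ij}}(X_i,Y_j)&-g_{e_{ij}}(X_i,Y_{j+1})\\ g_{e_{ij}}(X_{i+1},y)&-g_{e_{ij}}(X_{i+1},Y_j)&-g_{e_{ij}}(X_{i+1},Y_{j+1})\end{bmatrix},\quad \mathbf{M}_b=\begin{bmatrix}0&H_{ij}(x)&H_{i,j+1}(x)\\ G_{ij}(y)&-\hat\alpha_{ij}&-\hat\alpha_{i,j+1}\\ G_{i+1,j}(y)&-\hat\alpha_{i+1,j}&-\hat\alpha_{i+1,j+1}\end{bmatrix}.$$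 Then: (i) For arbitrary functions $g_{e_{ij}}$, $\hat G_{ij}$, $\hat H_{ij}$ and arbitrary values of the parameters $\hat\alpha_{ij}$, the functions $u_{e_{ij}}$ given by $(\ast\ast)$ satisfy $(\ast)$. (ii) Any piecewise function, given by functions $u_{e_{ij}}:\Omega_{ij}\to\mathbb{R}$ ($0\leq i\leq N_x-1$, $0\leq j\leq N_y-1$) satisfying $(\ast)$, can be expressed in the form $(\ast\ast)$ for some $g_{e_{ij}}$, $\hat G_{ij}$, $\hat H_{ij}$ and some values of the parameters $\hat\alpha_{ij}$.
   Context: For real numbers $s<t$: $\phi_0(s,t,x)=\dfrac{t-x}{t-s}$ and $\phi_1(s,t,x)=\dfrac{x-s}{t-s}$. The element $\Omega_{ij}$ has index $e_{ij}=iN_y+j$, so $u_{e_{ij}}$ is simply the function attached to $\Omega_{ij}$. *)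

(* Defs.v *)
(* The real numbers are an arbitrary R : realType. *)
From mathcomp Require Import all_boot all_order all_algebra.
From mathcomp Require Import reals.

Set Implicit Arguments.
Unset Strict Implicit.
Unset Printing Implicit Defensive.

Import Order.TTheory GRing.Theory Num.Theory.
Local Open Scope ring_scope.

(* A function on a cell, or on an edge of a cell, is represented by a total
   function on R * R, or on R; a family indexed by a finite range of indices is
   represented by a family over nat. All the conditions below only constrain,
   and only involve, the values at points of the cells and edges and at indices
   in the ranges, so values elsewhere are irrelevant. *)

Definition phi0 (R : realType) (s t x : R) : R := (t - x) / (t - s).
Definition phi1 (R : realType) (s t x : R) : R := (x - s) / (t - s).

Definition grid (R : realType) (N : nat) (a b : R) (X : nat -> R) : Prop :=
  [/\ X 0%N = a, X N = b & forall i, (i < N)%N -> X i < X i.+1].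

Definition in_cell (R : realType) (X Y : nat -> R) (i j : nat) (x y : R) : bool :=
  (x \in `[X i, X i.+1]) && (y \in `[Y j, Y j.+1]).

Definition C0_conditions (R : realType) (Nx Ny : nat) (X Y : nat -> R)
    (u : nat -> nat -> R -> R -> R) : Prop :=
  (forall i j : nat, (i.+1 < Nx)%N -> (j < Ny)%N ->
     forall y, y \in `[Y j, Y j.+1] -> u i j (X i.+1) y = u i.+1 j (X i.+1) y)
  /\
  (forall i j : nat, (i < Nx)%N -> (j.+1 < Ny)%N ->
     forall x, x \in `[X i, X i.+1] -> u i j x (Y j.+1) = u i j.+1 x (Y j.+1)).

Definition col3 (R : realType) (a b c : R) : 'cV[R]_3 :=
  \col_(k < 3) [:: a; b; c]`_k.

Definition mx33 (R : realType) (rows : seq (seq R)) : 'M[R]_3 :=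
  \matrix_(k < 3, l < 3) (nth [::] rows k)`_l.

Definition edgeG (R : realType) (Y : nat -> R) (Ghat : nat -> nat -> R -> R)
    (alpha : nat -> nat -> R) (i j : nat) (y : R) : R :=
  Ghat i j y + (alpha i j - Ghat i j (Y j)) * phi0 (Y j) (Y j.+1) y
    + (alpha i j.+1 - Ghat i j (Y j.+1)) * phi1 (Y j) (Y j.+1) y.

Definition edgeH (R : realType) (X : nat -> R) (Hhat : nat -> nat -> R -> R)
    (alpha : nat -> nat -> R) (i j : nat) (x : R) : R :=
  Hhat i j x + (alpha i j - Hhat i j (X i)) * phi0 (X i) (X i.+1) x
    + (alpha i.+1 j - Hhat i j (X i.+1)) * phi1 (X i) (X i.+1) x.

Definition Mg (R : realType) (X Y : nat -> R) (g : nat -> nat -> R -> R -> R)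
    (i j : nat) (x y : R) : 'M[R]_3 :=
  mx33 [:: [:: 0;                 g i j x (Y j);            g i j x (Y j.+1)];
           [:: g i j (X i) y;    - g i j (X i) (Y j);    - g i j (X i) (Y j.+1)];
           [:: g i j (X i.+1) y; - g i j (X i.+1) (Y j); - g i j (X i.+1) (Y j.+1)]].

Definition Mb (R : realType) (X Y : nat -> R) (Ghat Hhat : nat -> nat -> R -> R)
    (alpha : nat -> nat -> R) (i j : nat) (x y : R) : 'M[R]_3 :=
  let G := edgeG Y Ghat alpha in
  let H := edgeH X Hhat alpha in
  mx33 [:: [:: 0;          H i j x;          H i j.+1 x];
           [:: G i j y;    - alpha i j;    - alpha i j.+1];
           [:: G i.+1 j y; - alpha i.+1 j; - alpha i.+1 j.+1]].

Definition has_form (R : realType) (Nx Ny : nat) (X Y : nat -> R)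
    (g : nat -> nat -> R -> R -> R) (Ghat Hhat : nat -> nat -> R -> R)
    (alpha : nat -> nat -> R) (u : nat -> nat -> R -> R -> R) : Prop :=
  forall i j : nat, (i < Nx)%N -> (j < Ny)%N ->
  forall x y : R, in_cell X Y i j x y ->
    let v1 := col3 1 (phi0 (X i) (X i.+1) x) (phi1 (X i) (X i.+1) x) in
    let v2 := col3 1 (phi0 (Y j) (Y j.+1) y) (phi1 (Y j) (Y j.+1) y) in
    u i j x y = g i j x y
      - (v1^T *m Mg X Y g i j x y *m v2) 0 0
      + (v1^T *m Mb X Y Ghat Hhat alpha i j x y *m v2) 0 0.

(* Main.v *)
Require Import Defs.
From mathcomp Require Import all_boot all_order all_algebra.
From mathcomp Require Import reals.
From mathcomp Require Import ring.

Set Implicit Arguments.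
Unset Strict Implicit.
Unset Printing Implicit Defensive.

Import Order.TTheory GRing.Theory Num.Theory.
Local Open Scope ring_scope.

(** For edge data and corner values that agree at the corners of a cell, the
    form [v1^T M v2] is the transfinite (Coons) interpolant of these data: on
    each edge of the cell it takes the prescribed edge values. Hence the
    [Mg] term cancels [g] on the boundary of the cell, and a function of the
    given form equals [edgeG] on the vertical edges and [edgeH] on the
    horizontal ones ([edgeG] and [edgeH] being corrected to take the values
    [alpha] at the nodes). These are attached to the edges, not to the cells,
    so the two cells sharing an edge give the same values there: this is (i).

    Conversely, given a continuous piecewise function [u], take [g := u] and
    let the edge functions and node parameters be the restrictions of [u] to
    the edges and nodes. The conditions make these restrictions independent of
    the adjacent cell used to compute them, the corrections in [edgeG] and
    [edgeH] vanish, so [Mb = Mg] in every cell and the formula reads [u = u]. *)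

Section Coons.
Variable R : realType.
Implicit Types (s t p q : R) (X Y : nat -> R).

Lemma phi0_left s t : s < t -> phi0 s t s = 1.
Proof. by move=> st; rewrite /phi0 divff // subr_eq0 gt_eqF. Qed.

Lemma phi0_right s t : phi0 s t t = 0.
Proof. by rewrite /phi0 subrr mul0r. Qed.

Lemma phi1_left s t : phi1 s t s = 0.
Proof. by rewrite /phi1 subrr mul0r. Qed.

Lemma phi1_right s t : s < t -> phi1 s t t = 1.
Proof. by move=> st; rewrite /phi1 divff // subr_eq0 gt_eqF. Qed.

Lemma coons_formE p0 p1 q0 q1 h0 h1 g0 g1 c00 c01 c10 c11 :
  ((col3 1 p0 p1)^T
     *m mx33 [:: [:: 0; h0; h1]; [:: g0; - c00; - c01]; [:: g1; - c10; - c11]]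
     *m col3 1 q0 q1) 0 0
  = p0 * g0 + p1 * g1 + q0 * h0 + q1 * h1
    - (p0 * q0 * c00 + p0 * q1 * c01 + p1 * q0 * c10 + p1 * q1 * c11) :> R.
Proof.
rewrite !(mxE, big_ord_recl, big_ord0) /=.
ring.
Qed.

Lemma edgeG_bottom Y Ghat alpha i j :
  Y j < Y j.+1 -> edgeG Y Ghat alpha i j (Y j) = alpha i j.
Proof. by move=> Yj; rewrite /edgeG phi0_left // phi1_left; ring. Qed.

Lemma edgeG_top Y Ghat alpha i j :
  Y j < Y j.+1 -> edgeG Y Ghat alpha i j (Y j.+1) = alpha i j.+1.
Proof. by move=> Yj; rewrite /edgeG phi0_right phi1_right //; ring. Qed.

Lemma edgeH_left X Hhat alpha i j :
  X i < X i.+1 -> edgeH X Hhat alpha i j (X i) = alpha i j.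
Proof. by move=> Xi; rewrite /edgeH phi0_left // phi1_left; ring. Qed.

Lemma edgeH_right X Hhat alpha i j :
  X i < X i.+1 -> edgeH X Hhat alpha i j (X i.+1) = alpha i.+1 j.
Proof. by move=> Xi; rewrite /edgeH phi0_right phi1_right //; ring. Qed.

(** If [Ghat] already takes the values [alpha] at both ends of the edge, the
    linear correction in [edgeG] vanishes. *)
Lemma edgeG_id Y Ghat alpha i j y :
  alpha i j = Ghat i j (Y j) -> alpha i j.+1 = Ghat i j (Y j.+1) ->
  edgeG Y Ghat alpha i j y = Ghat i j y.
Proof. by move=> e0 e1; rewrite /edgeG e0 e1; ring. Qed.

Lemma edgeH_id X Hhat alpha i j x :
  alpha i j = Hhat i j (X i) -> alpha i.+1 j = Hhat i j (X i.+1) ->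
  edgeH X Hhat alpha i j x = Hhat i j x.
Proof. by move=> e0 e1; rewrite /edgeH e0 e1; ring. Qed.

(** In a cell of the given form, the two terms involving [g] cancel on the
    boundary, and the corner terms cancel the edge functions of the other
    direction, since these take the values [alpha] at the nodes. *)
Section BoundaryValues.
Variables (Nx Ny : nat) (X Y : nat -> R) (g : nat -> nat -> R -> R -> R).
Variables (Ghat Hhat : nat -> nat -> R -> R) (alpha : nat -> nat -> R).
Variable u : nat -> nat -> R -> R -> R.
Hypothesis Xincr : forall i, (i < Nx)%N -> X i < X i.+1.
Hypothesis Yincr : forall j, (j < Ny)%N -> Y j < Y j.+1.
Hypothesis uform : has_form Nx Ny X Y g Ghat Hhat alpha u.
Variables i j : nat.
Hypotheses (iNx : (i < Nx)%N) (jNy : (j < Ny)%N).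

Let Xi := Xincr iNx.
Let Yj := Yincr jNy.

Lemma has_form_left y :
  y \in `[Y j, Y j.+1] -> u i j (X i) y = edgeG Y Ghat alpha i j y.
Proof.
move=> yY; rewrite uform //; last by rewrite /in_cell yY bound_in_itv bnd_simp ltW.
by rewrite !coons_formE phi0_left // phi1_left !edgeH_left //; ring.
Qed.

Lemma has_form_right y :
  y \in `[Y j, Y j.+1] -> u i j (X i.+1) y = edgeG Y Ghat alpha i.+1 j y.
Proof.
move=> yY; rewrite uform //; last by rewrite /in_cell yY bound_in_itv bnd_simp ltW.
by rewrite !coons_formE phi0_right phi1_right // !edgeH_right //; ring.
Qed.

Lemma has_form_bottom x :
  x \in `[X i, X i.+1] -> u i j x (Y j) = edgeH X Hhat alpha i j x.
Proof.
move=> xX; rewrite uform //; last by rewrite /in_cell xX bound_in_itv bnd_simp ltW.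
by rewrite !coons_formE phi0_left // phi1_left !edgeG_bottom //; ring.
Qed.

Lemma has_form_top x :
  x \in `[X i, X i.+1] -> u i j x (Y j.+1) = edgeH X Hhat alpha i j.+1 x.
Proof.
move=> xX; rewrite uform //; last by rewrite /in_cell xX bound_in_itv bnd_simp ltW.
by rewrite !coons_formE phi0_right phi1_right // !edgeG_top //; ring.
Qed.

End BoundaryValues.

Lemma has_form_C0 Nx Ny X Y g Ghat Hhat alpha (u : nat -> nat -> R -> R -> R) :
  (forall i, (i < Nx)%N -> X i < X i.+1) ->
  (forall j, (j < Ny)%N -> Y j < Y j.+1) ->
  has_form Nx Ny X Y g Ghat Hhat alpha u -> C0_conditions Nx Ny X Y u.
Proof.
move=> Xincr Yincr uform; split=> i j iNx jNy.
  move=> y yY; rewrite (has_form_right Xincr uform (ltnW iNx) jNy yY).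
  by rewrite (has_form_left Xincr uform iNx jNy yY).
move=> x xX; rewrite (has_form_top Yincr uform iNx (ltnW jNy) xX).
by rewrite (has_form_bottom Yincr uform iNx jNy xX).
Qed.

(** Among the [N] cells of a grid with nodes [0 .. N], the index of one that
    contains node [k]: the cell starting at [k], or the last one if [k = N]. *)
Definition cell_of_node (N k : nat) : nat := if (k < N)%N then k else N.-1.

Lemma cell_of_node_lt N k : (k < N)%N -> cell_of_node N k = k.
Proof. by rewrite /cell_of_node => ->. Qed.

Lemma cell_of_nodeS N k :
  (k < N)%N ->
  cell_of_node N k.+1 = k /\ k.+1 = N
  \/ cell_of_node N k.+1 = k.+1 /\ (k.+1 < N)%N.
Proof.
rewrite /cell_of_node => kN; case: ltnP => [|Nk]; [by right | left].
have -> : N = k.+1 by apply/eqP; rewrite eqn_leq Nk kN.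
by [].
Qed.

Section Traces.
Variables (Nx Ny : nat) (X Y : nat -> R) (u : nat -> nat -> R -> R -> R).
Hypothesis Xincr : forall i, (i < Nx)%N -> X i < X i.+1.
Hypothesis Yincr : forall j, (j < Ny)%N -> Y j < Y j.+1.
Hypothesis uC0 : C0_conditions Nx Ny X Y u.

(** The restrictions of [u] to the vertical edges, to the horizontal edges and
    to the nodes, each computed in one adjacent cell. *)
Definition vtrace (i j : nat) (y : R) : R := u (cell_of_node Nx i) j (X i) y.
Definition htrace (i j : nat) (x : R) : R := u i (cell_of_node Ny j) x (Y j).
Definition node_trace (i j : nat) : R :=
  u (cell_of_node Nx i) (cell_of_node Ny j) (X i) (Y j).

Lemma vtrace_left i j y : (i < Nx)%N -> vtrace i j y = u i j (X i) y.
Proof. by move=> iNx; rewrite /vtrace cell_of_node_lt. Qed.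

Lemma vtrace_right i j y :
  (i < Nx)%N -> (j < Ny)%N -> y \in `[Y j, Y j.+1] ->
  vtrace i.+1 j y = u i j (X i.+1) y.
Proof.
move=> iNx jNy yY; rewrite /vtrace.
by have [[-> _] //|[-> iNx']] := cell_of_nodeS iNx; rewrite uC0.1.
Qed.

Lemma htrace_bottom i j x : (j < Ny)%N -> htrace i j x = u i j x (Y j).
Proof. by move=> jNy; rewrite /htrace cell_of_node_lt. Qed.

Lemma htrace_top i j x :
  (i < Nx)%N -> (j < Ny)%N -> x \in `[X i, X i.+1] ->
  htrace i j.+1 x = u i j x (Y j.+1).
Proof.
move=> iNx jNy xX; rewrite /htrace.
by have [[-> _] //|[-> jNy']] := cell_of_nodeS jNy; rewrite uC0.2.
Qed.

Section Corners.
Variables i j : nat.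
Hypotheses (iNx : (i < Nx)%N) (jNy : (j < Ny)%N).

Let Xl : X i \in `[X i, X i.+1]. Proof. by rewrite bound_in_itv bnd_simp ltW ?Xincr. Qed.
Let Xr : X i.+1 \in `[X i, X i.+1]. Proof. by rewrite bound_in_itv bnd_simp ltW ?Xincr. Qed.
Let Yb : Y j \in `[Y j, Y j.+1]. Proof. by rewrite bound_in_itv bnd_simp ltW ?Yincr. Qed.
Let Yt : Y j.+1 \in `[Y j, Y j.+1]. Proof. by rewrite bound_in_itv bnd_simp ltW ?Yincr. Qed.

Lemma node_trace_left_bottom : node_trace i j = u i j (X i) (Y j).
Proof. by rewrite /node_trace !cell_of_node_lt. Qed.

Lemma node_trace_left_top : node_trace i j.+1 = u i j (X i) (Y j.+1).
Proof. by rewrite /node_trace (cell_of_node_lt iNx) -htrace_top. Qed.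

Lemma node_trace_right_bottom : node_trace i.+1 j = u i j (X i.+1) (Y j).
Proof. by rewrite /node_trace (cell_of_node_lt jNy) -vtrace_right. Qed.

(** The corner shared by up to four cells: [htrace_top] changes the row in
    which [u] is computed, [vtrace_right] the column. *)
Lemma node_trace_right_top : node_trace i.+1 j.+1 = u i j (X i.+1) (Y j.+1).
Proof.
rewrite -htrace_top // /node_trace /htrace -/(vtrace i.+1 _ _).
have [[-> _]|[-> jNy']] := cell_of_nodeS jNy; first by rewrite vtrace_right.
by rewrite vtrace_right // bound_in_itv bnd_simp ltW ?Yincr.
Qed.

(** Seen from any of the cells, the corrected edge functions built from the
    traces are the restrictions of the cell's own function to its four edges. *)
Lemma edge_traces x y : in_cell X Y i j x y ->
  [/\ edgeG Y vtrace node_trace i j y = u i j (X i) y,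
      edgeG Y vtrace node_trace i.+1 j y = u i j (X i.+1) y,
      edgeH X htrace node_trace i j x = u i j x (Y j)
    & edgeH X htrace node_trace i j.+1 x = u i j x (Y j.+1)].
Proof.
case/andP=> xX yY; split.
- rewrite edgeG_id ?vtrace_left //.
    exact: node_trace_left_bottom.
  exact: node_trace_left_top.
- rewrite edgeG_id ?vtrace_right //.
    exact: node_trace_right_bottom.
  exact: node_trace_right_top.
- rewrite edgeH_id ?htrace_bottom //.
    exact: node_trace_left_bottom.
  exact: node_trace_right_bottom.
- rewrite edgeH_id ?htrace_top //.
    exact: node_trace_left_top.
  exact: node_trace_right_top.
Qed.

End Corners.

(** With [g := u] and the traces of [u] as boundary data, [Mb] and [Mg] agree
    and the form reduces to [u = u]. *)
Lemma C0_has_form : has_form Nx Ny X Y u vtrace htrace node_trace u.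
Proof.
move=> i j iNx jNy x y xy /=.
have [Gl Gr Hb Ht] := edge_traces iNx jNy xy.
suff -> : Mb X Y vtrace htrace node_trace i j x y = Mg X Y u i j x y.
  by rewrite subrK.
rewrite /Mb /Mg Gl Gr Hb Ht.
by rewrite node_trace_left_bottom // node_trace_left_top //
           node_trace_right_bottom // node_trace_right_top.
Qed.

End Traces.
End Coons.

Theorem theorem6 (R : realType) (Nx Ny : nat) (a1 b1 a2 b2 : R) (X Y : nat -> R)
    (hNx : (1 <= Nx)%N) (hNy : (1 <= Ny)%N)
    (hX : grid Nx a1 b1 X) (hY : grid Ny a2 b2 Y) :
  (forall (g : nat -> nat -> R -> R -> R) (Ghat Hhat : nat -> nat -> R -> R)
          (alpha : nat -> nat -> R) (u : nat -> nat -> R -> R -> R),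
     has_form Nx Ny X Y g Ghat Hhat alpha u -> C0_conditions Nx Ny X Y u)
  /\
  (forall u : nat -> nat -> R -> R -> R,
     C0_conditions Nx Ny X Y u ->
     exists (g : nat -> nat -> R -> R -> R) (Ghat Hhat : nat -> nat -> R -> R)
            (alpha : nat -> nat -> R),
       has_form Nx Ny X Y g Ghat Hhat alpha u).
Proof.
have [_ _ Xincr] := hX; have [_ _ Yincr] := hY; split.
  by move=> g Ghat Hhat alpha u; apply: has_form_C0.
move=> u uC0; exists u, (vtrace Nx X u), (htrace Ny Y u), (node_trace Nx Ny X Y u).
exact: C0_has_form.
Qed.
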